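(* Let $K$ be a perfect field and fix an algebraic closure $\bar K$. Let $f(x)\in K[x]$ be the minimal polynomial over $K$ of an element $\alpha\in\bar K$ of degree $n>2$ over $K$, suppose $f$ has root cluster size $r$, and let $K_f\subset\bar K$ be the splitting field of $f$ over $K$. Assume that there is a finite Galois extension of $K$ (inside $\bar K$), of some degree $d$, which is linearly disjoint with $K_f$ over $K$. Then there exists an irreducible polynomial $g(x)\in K[x]$ of degree $nd$ with root cluster size $rd$.
   Context: For an irreducible polynomial $h(x)$ over a perfect field $K$ and a root $\gamma$ of $h$ in $\bar K$, the root cluster of $\gamma$ is the set of roots of $h$ lying in the field $K(\gamma)$; its cardinality is the root cluster size of $\gamma$. This number does not depend on the choice of the root $\gamma$, and it is called the (root) cluster size of $h$. *)

(* Defs.v *)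
From HB Require Import structures.
From mathcomp Require Import all_boot all_order all_algebra all_field.
From mathcomp Require Import boolp classical_sets functions cardinality.

Set Implicit Arguments.
Unset Strict Implicit.
Unset Printing Implicit Defensive.

Import GRing.Theory.
Local Open Scope ring_scope.
Local Open Scope classical_set_scope.

Definition perfect_field (K : fieldType) : Prop :=
  forall p : {poly K}, irreducible_poly p -> separable_poly p.

(* The target is algebraically closed by its type, so only algebraicity over
   the image of iota has to be required. *)
Definition algebraic_closure (K : fieldType) (Kbar : closedFieldType)
    (iota : {rmorphism K -> Kbar}) : Prop :=
  forall x : Kbar, algebraicOver iota x.

Definition min_poly (K : fieldType) (Kbar : closedFieldType)
    (iota : {rmorphism K -> Kbar}) (alpha : Kbar) (f : {poly K}) : Prop :=
  [/\ f \is monic, root (map_poly iota f) alpha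
    & forall q : {poly K},
        q != 0 -> root (map_poly iota q) alpha -> (size f <= size q)%N].

Definition poly_roots (K : fieldType) (Kbar : closedFieldType)
    (iota : {rmorphism K -> Kbar}) (h : {poly K}) : set Kbar :=
  [set x | root (map_poly iota h) x].

(* K(S): the smallest subfield of Kbar that contains K and S. *)
Definition adjoin (K : fieldType) (Kbar : closedFieldType)
    (iota : {rmorphism K -> Kbar}) (S : set Kbar) : set Kbar :=
  smallest (fun E : set Kbar => divring_closed [in E]) (range iota `|` S).

Definition splitting_field (K : fieldType) (Kbar : closedFieldType)
    (iota : {rmorphism K -> Kbar}) (h : {poly K}) : set Kbar :=
  adjoin iota (poly_roots iota h).

Definition root_cluster (K : fieldType) (Kbar : closedFieldType)
    (iota : {rmorphism K -> Kbar}) (h : {poly K}) (gamma : Kbar) : set Kbar :=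
  poly_roots iota h `&` adjoin iota [set gamma].

(* For irreducible h the cardinality is the same for all roots gamma, and h has
   a root in Kbar, so "for every root" and "for some root" agree. *)
Definition cluster_size (K : fieldType) (Kbar : closedFieldType)
    (iota : {rmorphism K -> Kbar}) (h : {poly K}) (m : nat) : Prop :=
  forall gamma : Kbar, root (map_poly iota h) gamma ->
    (root_cluster iota h gamma #= `I_m)%card.

(* A finite Galois extension E of K inside Kbar, of degree d, is the image of an
   abstract one under a K-embedding. *)
Definition galois_subextension (K : fieldType) (Kbar : closedFieldType)
    (iota : {rmorphism K -> Kbar}) (E : set Kbar) (d : nat) : Prop :=
  exists (L : splittingFieldType K) (j : {rmorphism L -> Kbar}),
    [/\ forall a : K, j (a%:A) = iota a, E = range j,
        galois 1%AS {:L}%AS & \dim {:L} = d].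

Definition lin_indep_over (Kbar : fieldType) (F : set Kbar)
    (m : nat) (v : 'I_m -> Kbar) : Prop :=
  forall c : 'I_m -> Kbar, (forall i, F (c i)) ->
    \sum_(i < m) c i * v i = 0 -> forall i, c i = 0.

Definition linearly_disjoint (K : fieldType) (Kbar : closedFieldType)
    (iota : {rmorphism K -> Kbar}) (E F : set Kbar) : Prop :=
  forall (m : nat) (v : 'I_m -> Kbar), (forall i, E (v i)) ->
    lin_indep_over (range iota) v -> lin_indep_over F v.

(* Main.v *)
(** Let b be the minimal polynomial of a generator of the Galois extension E and
    let z = P(x, y) be a primitive element of K(x, y), for x a root of f and y a
    root of b, with x = A(z) and y = B(z). Linear disjointness makes the powers
    y^k (k < d) free over the splitting field of f, so a polynomial relation
    over K satisfied by one pair (x, y) of roots holds for all pairs. Hence the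
    minimal polynomial g of z has exactly the nd roots P(x, y). Since E is
    normal, P(x', y') lies in K(P(x, y)) iff x' lies in K(x, y), and by freeness
    again iff x' lies in K(x). So each cluster of g is in bijection with the
    product of a cluster of f and the set of roots of b. *)

Require Import Defs.
From HB Require Import structures.
From mathcomp Require Import all_boot all_order all_algebra all_field finmap.
From mathcomp Require Import boolp classical_sets functions cardinality.

Set Implicit Arguments.
Unset Strict Implicit.
Unset Printing Implicit Defensive.

Import GRing.Theory.
Local Open Scope ring_scope.
Local Open Scope classical_set_scope.

(** * Irreducible polynomials and their roots *)

(** A nonzero polynomial of least size among those vanishing at [x] is irreducible. *)
Lemma algebraic_irreducible (F E : fieldType) (i : {rmorphism F -> E}) (x : E) :
  algebraicOver i x ->
  exists p : {poly F}, irreducible_poly p /\ root (map_poly i p) x.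
Proof.
move=> [q q_neq0 qx].
pose P m := `[< exists p : {poly F},
  [/\ size p = m, p != 0 & root (map_poly i p) x] >].
have exP : exists m, P m by exists (size q); apply/asboolP; exists q.
case: (ex_minnP exP) => m /asboolP[p [<- p_neq0 px]] min_p.
exists p; split=> //; apply/(subfx_irreducibleP px p_neq0) => p' p'x p'_neq0.
by apply: min_p; apply/asboolP; exists p'.
Qed.

(** Otherwise [h] and [q] would be coprime, and coprime polynomials have no common root, even in an
    extension. *)
Lemma irreducible_dvdp (F E : fieldType) (i : {rmorphism F -> E}) (x : E)
    (h q : {poly F}) :
  irreducible_poly h -> root (map_poly i h) x -> root (map_poly i q) x ->
  h %| q.
Proof.
move=> irr_h hx qx; have := irreducible_poly_coprime q irr_h.
case: (h %| q) => //=; rewrite -(coprimep_map i) => cop.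
by move: (coprimep_root cop hx); rewrite (rootP qx) eqxx.
Qed.

(** Perfectness makes [h] separable, so its linear factors over [Kbar] are distinct and there are as
    many roots as the degree. *)
Lemma irreducible_roots (K : fieldType) (Kbar : closedFieldType)
    (iota : {rmorphism K -> Kbar}) (h : {poly K}) :
  perfect_field K -> irreducible_poly h ->
  exists s : seq Kbar, [/\ uniq s, size h = (size s).+1
    & forall x, root (map_poly iota h) x = (x \in s)].
Proof.
move=> perfK irr_h; have h_neq0 := irredp_neq0 irr_h.
have [s Dh] := closed_field_poly_normal (map_poly iota h).
have lc_neq0 : lead_coef (map_poly iota h) != 0.
  by rewrite lead_coef_eq0 map_poly_eq0.
exists s; split.
- have := perfK _ irr_h; rewrite -(separable_map iota) Dh.
  by rewrite (eqp_separable (eqp_scale _ lc_neq0)) separable_prod_XsubC.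
- by rewrite -(size_map_poly iota) Dh size_scale // size_prod_XsubC.
- by move=> x; rewrite Dh rootZ // root_prod_XsubC.
Qed.

(** * Subfields of [Kbar] generated over [K] *)

Section Adjoin.

Variables (K : fieldType) (Kbar : closedFieldType).
Variable iota : {rmorphism K -> Kbar}.
Implicit Types (S : set Kbar) (x y : Kbar).

Lemma adjoin_divring_closed S : divring_closed [in adjoin iota S].
Proof.
have inE' z : reflect (forall E : set Kbar, divring_closed [in E] ->
    (range iota `|` S `<=` E) -> E z) (z \in adjoin iota S).
  apply: (iffP idP) => [/set_mem adz E divE sub | H]; first exact: adz.
  by apply/mem_set => E [divE sub]; apply: H.
split=> [|x y /inE' xA /inE' yA|x y /inE' xA /inE' yA]; apply/inE' => E divE sub;
  have [E1 EB EV] := divE; apply: set_mem.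
- exact: E1.
- by apply: EB; apply/mem_set; [apply: xA | apply: yA].
- by apply: EV; apply/mem_set; [apply: xA | apply: yA].
Qed.

Lemma sub_adjoin S : S `<=` adjoin iota S.
Proof. by move=> x Sx E [_ sub]; apply: sub; right. Qed.

Lemma adjoin_base S a : adjoin iota S (iota a).
Proof. by move=> E [_ sub]; apply: sub; left; exists a. Qed.

Lemma adjoinB S x y : adjoin iota S x -> adjoin iota S y -> adjoin iota S (x - y).
Proof.
have [_ clB _] := adjoin_divring_closed S.
by move=> /mem_set xS /mem_set yS; apply/set_mem/clB.
Qed.

(** Since [divring_closed] offers subtraction and division, the sum is written x - (0 - y); likewise
    the product below is x / (1 / y), which is valid for y = 0 too. *)
Lemma adjoinD S x y : adjoin iota S x -> adjoin iota S y -> adjoin iota S (x + y).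
Proof.
move=> xS yS; rewrite -(opprK y) -[- y]sub0r -(rmorph0 iota).
by apply: adjoinB => //; apply: adjoinB => //; apply: adjoin_base.
Qed.

Lemma adjoinM S x y : adjoin iota S x -> adjoin iota S y -> adjoin iota S (x * y).
Proof.
have [_ _ clV] := adjoin_divring_closed S.
have adV u v : adjoin iota S u -> adjoin iota S v -> adjoin iota S (u / v).
  by move=> /mem_set uS /mem_set vS; apply/set_mem/clV.
move=> xS yS; rewrite -(invrK y) -[y^-1]div1r -(rmorph1 iota).
by apply: (adV) => //; apply: (adV) => //; apply: adjoin_base.
Qed.

Lemma adjoin_horner S (p : {poly Kbar}) x :
  (forall k, adjoin iota S p`_k) -> adjoin iota S x -> adjoin iota S p.[x].
Proof.
move=> pS xS; rewrite horner_coef.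
elim/big_ind: _ => [|u v|k _]; first by rewrite -(rmorph0 iota); apply: adjoin_base.
  exact: adjoinD.
apply: adjoinM => //; elim: (nat_of_ord k) => [|m IHm].
  by rewrite expr0 -(rmorph1 iota); apply: adjoin_base.
by rewrite exprS; apply: adjoinM.
Qed.

Lemma adjoin_map_horner S (p : {poly K}) x :
  adjoin iota S x -> adjoin iota S (map_poly iota p).[x].
Proof.
by move=> xS; apply: adjoin_horner => // k; rewrite coef_map; apply: adjoin_base.
Qed.

(** For algebraic [x] the ring K[x] is already a field, hence equal to K(x). *)
Lemma adjoin1P (h : {poly K}) (x y : Kbar) :
  irreducible_poly h -> root (map_poly iota h) x ->
  adjoin iota [set x] y <-> exists p : {poly K}, y = (map_poly iota p).[x].
Proof.
move=> irr_h hx; split=> [|[p ->]]; last first.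
  by apply: adjoin_map_horner; apply: sub_adjoin.
pose E := [set z : Kbar | exists p : {poly K}, z = (map_poly iota p).[x]].
suff: adjoin iota [set x] `<=` E by move=> sub /sub.
apply: smallest_sub; last first.
  move=> z [[a _ <-]|->]; first by exists a%:P; rewrite map_polyC hornerC.
  by exists 'X; rewrite map_polyX hornerX.
split=> [|u v /set_mem[p ->] /set_mem[q ->]|u v /set_mem[p ->] /set_mem[q ->]].
- by apply/mem_set; exists 1; rewrite rmorph1 hornerC.
- by apply/mem_set; exists (p - q); rewrite rmorphB hornerD hornerN.
(* If [h] divides [q], the denominator q(x) is 0 and the quotient is 0 by the convention on
   inverses. *)
apply/mem_set; have [hq|nhq] := boolP (h %| q).
  exists 0; have /dvdpP[k ->] := hq.
  by rewrite rmorph0 horner0 rmorphM hornerM (rootP hx) mulr0 invr0 mulr0.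
(* Evaluating the Bezout relation a h + c q = 1 at [x] shows that c(x) is the inverse of q(x). *)
have /Bezout_eq1_coprimepP[[a c] /= /(congr1 (fun P => (map_poly iota P).[x]))] :
  coprimep h q by rewrite irreducible_poly_coprime.
rewrite rmorphD !rmorphM rmorph1 hornerD !hornerM (rootP hx) mulr0 add0r hornerC.
move=> cq1; exists (p * c); rewrite rmorphM hornerM; congr (_ * _).
have q_neq0 : (map_poly iota q).[x] != 0.
  by apply: contra_eq_neq cq1 => ->; rewrite mulr0 eq_sym oner_eq0.
by apply: (mulIf q_neq0); rewrite cq1 mulVf.
Qed.

End Adjoin.

(** * Evaluation of bivariate polynomials at pairs *)

Section Bivariate.

Variables (K : fieldType) (Kbar : closedFieldType).
Variable iota : {rmorphism K -> Kbar}.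

(* P is a polynomial in Y with coefficients in K[X]; horner2 x y P is P(x, y). *)
Definition horner2 (x y : Kbar) : {poly {poly K}} -> Kbar :=
  horner_eval y \o map_poly (horner_eval x \o map_poly iota).

HB.instance Definition _ x y := GRing.RMorphism.on (horner2 x y).

Lemma horner2E x y P :
  horner2 x y P = (map_poly (horner_eval x \o map_poly iota) P).[y].
Proof. by []. Qed.

Lemma horner2B x y P Q : horner2 x y (P - Q) = horner2 x y P - horner2 x y Q.
Proof. exact: rmorphB. Qed.

Lemma horner2C x y p : horner2 x y p%:P = (map_poly iota p).[x].
Proof. by rewrite horner2E map_polyC hornerC. Qed.

Lemma horner2CC x y a : horner2 x y a%:P%:P = iota a.
Proof. by rewrite horner2C map_polyC hornerC. Qed.

Lemma horner2X x y : horner2 x y 'X = y.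
Proof. by rewrite horner2E map_polyX hornerX. Qed.

(* p(P(X, Y)) *)
Definition comp2 (p : {poly K}) (P : {poly {poly K}}) : {poly {poly K}} :=
  (map_poly (polyC \o polyC) p).[P].

Lemma horner2_comp x y p P :
  horner2 x y (comp2 p P) = (map_poly iota p).[horner2 x y P].
Proof.
rewrite /comp2 -horner_map -map_poly_comp; congr _.[_].
by apply: eq_map_poly => a /=; rewrite horner2CC.
Qed.

(** [map_poly polyC p] is p(Y), whereas [p%:P] is p(X). *)
Lemma horner2_map x y p : horner2 x y (map_poly polyC p) = (map_poly iota p).[y].
Proof.
rewrite horner2E -map_poly_comp; congr _.[_].
by apply: eq_map_poly => a /=; rewrite map_polyC /= /horner_eval hornerC.
Qed.

(** Division by the monic b(Y) is possible over the ring K[X]. The remainder [R] depends on neither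
    [x] nor [y], which is what allows relations to be moved from one pair of roots to another. *)
Lemma horner2_reduce (b : {poly K}) (P : {poly {poly K}}) : b \is monic ->
  exists R : {poly {poly K}}, (size R < size b)%N /\
  forall x y, root (map_poly iota b) y -> horner2 x y P = horner2 x y R.
Proof.
move=> mon_b; pose bb : {poly {poly K}} := map_poly polyC b.
have mon_bb : bb \is monic by rewrite map_monic.
exists (Pdiv.Ring.rmodp P bb); split=> [|x y by0].
  have <- : size bb = size b by rewrite size_map_inj_poly // ; apply: polyC_inj.
  by rewrite Pdiv.Ring.ltn_rmodp monic_neq0.
rewrite {1}(Pdiv.RingMonic.rdivp_eq mon_bb P) rmorphD rmorphM /=.
by rewrite [X in _ * X]horner2_map (rootP by0) mulr0 add0r.
Qed.

End Bivariate.

(** * Primitive elements for K(x, y) *)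

(** A model of K(x, y) as an abstract finite extension, in which dimensions and the primitive
    element theorem are available. It is a tower of two simple extensions. *)
Lemma two_generator_extension (K E : fieldType) (iota : {rmorphism K -> E})
    (x y : E) :
  algebraicOver iota x -> algebraicOver iota y ->
  exists (M : fieldExtType K) (k : {rmorphism M -> E}) (u v : M),
    [/\ forall a, k a%:A = iota a, k u = x & k v = y].
Proof.
move=> algx [q q_neq0 qy].
have [p [irr_p px]] := algebraic_irreducible algx.
have p_neq0 := irredp_neq0 irr_p.
pose L := SubFieldExtType px irr_p.
pose j : {rmorphism L -> E} := @subfx_inj _ _ iota x p.
have jE a : j a%:A = iota a by apply: subfx_inj_base.
have algy : algebraicOver j y.
  exists (map_poly (in_alg L) q); first by rewrite map_poly_eq0.
  by rewrite -map_poly_comp (eq_map_poly jE).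
have [p' [irr_p' p'y]] := algebraic_irreducible algy.
have p'_neq0 := irredp_neq0 irr_p'.
pose M' : fieldExtType L := SubFieldExtType p'y irr_p'.
pose k : {rmorphism M' -> E} := @subfx_inj _ _ j y p'.
have kE a : k a%:A = j a by apply: subfx_inj_base.
(* [M'] is an extension of [L]; [baseFieldType] restricts its scalars to [K]. *)
exists (baseFieldType M'), k, ((subfx_root iota x p : L)%:A : M').
exists (subfx_root j y p').
split=> [a||]; last exact: subfx_inj_root.
  by rewrite baseField_scaleE kE jE.
by rewrite kE; apply: subfx_inj_root.
Qed.

(** Only an upper bound on the degree of [g] is given here; equality comes later, from exhibiting
    enough roots of [g]. *)
Lemma primitive_pair (K : fieldType) (Kbar : closedFieldType)
    (iota : {rmorphism K -> Kbar}) (f b : {poly K}) (x y : Kbar) :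
  perfect_field K -> irreducible_poly f -> irreducible_poly b ->
  root (map_poly iota f) x -> root (map_poly iota b) y ->
  exists (g A B : {poly K}) (P : {poly {poly K}}),
    let z := horner2 iota x y P in
    [/\ irreducible_poly g /\ root (map_poly iota g) z,
        (size g <= ((size f).-1 * (size b).-1).+1)%N,
        x = (map_poly iota A).[z]
      & y = (map_poly iota B).[z]].
Proof.
move=> perfK irr_f irr_b fx b_y.
have f_neq0 := irredp_neq0 irr_f; have b_neq0 := irredp_neq0 irr_b.
have algx : algebraicOver iota x by exists f.
have algy : algebraicOver iota y by exists b.
have [M [k [u [v [kE ku kv]]]]] := two_generator_extension algx algy.
have kmap p w : k (map_poly (in_alg M) p).[w] = (map_poly iota p).[k w].
  by rewrite -horner_map -map_poly_comp (eq_map_poly kE).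
have rootM p w : root (map_poly iota p) (k w) -> root (map_poly (in_alg M) p) w.
  by move=> /rootP pw; apply/rootP/(fmorph_inj k); rewrite kmap pw rmorph0.
have fu : root (map_poly (in_alg M) f) u by apply: rootM; rewrite ku.
have bv : root (map_poly (in_alg M) b) v by apply: rootM; rewrite kv.
have sepv : separable_element 1 v.
  apply/separable_elementP; exists (map_poly (in_alg M) b).
  by split; rewrite ?alg_polyOver // separable_map; apply: perfK.
have [w defMw] := Primitive_Element_Theorem u sepv.
have uw : u \in <<1; w>>%VS by rewrite -defMw memv_adjoin.
have vw : v \in <<1; w>>%VS.
  by rewrite -defMw (subvP (subv_adjoin _ _)) ?memv_adjoin.
have wuv : w \in <<<<1; v>>; u>>%VS by rewrite defMw memv_adjoin.
have [A DA] := Fadjoin1_polyP uw; have [B DB] := Fadjoin1_polyP vw.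
have [Q /polyOverP Qv DQ] := Fadjoin_polyP wuv.
have /choice[R DR] i := Fadjoin1_polyP (Qv i).
(* [w] is Q(u) with coefficients in K(v), the i-th one being R_i(v). So [P'] is the sum of the
   R_i(Y) X^i. *)
pose P' := \sum_(i < size Q) (map_poly polyC (R i)) * ('X ^+ i)%:P : {poly {poly K}}.
have kP : horner2 iota x y P' = k w.
  rewrite DQ horner_coef !rmorph_sum; apply: eq_bigr => i _.
  rewrite !rmorphM /= DR horner2_map horner2C map_polyXn hornerXn rmorphXn.
  by rewrite kmap ku kv.
have /polyOver1P[g Dg] := minPolyOver 1 w.
have gw : root (map_poly (in_alg M) g) w by rewrite -Dg root_minPoly.
have szg : size g = (adjoin_degree 1 w).+1.
  by rewrite -size_minPoly Dg size_map_poly.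
have g_neq0 : g != 0 by rewrite -size_poly_eq0 szg.
exists g, A, B, P'; rewrite /= kP; split.
- have kgw : root (map_poly iota g) (k w) by rewrite rootE -kmap (rootP gw) rmorph0.
  split=> //; apply/(subfx_irreducibleP kgw g_neq0) => q qw q_neq0.
  rewrite -(size_map_poly (in_alg M)) -Dg -(size_map_poly (in_alg M) q).
  by rewrite dvdp_leq ?map_poly_eq0 // minPoly_dvdp ?alg_polyOver ?rootM.
(* By the tower formula the degree of [w] is that of [v] over [K] times that of [u] over K(v); these
   are at most the degrees of [b] and [f]. *)
- have := dim_Fadjoin 1 w; rewrite -defMw !dim_Fadjoin dimv1 !muln1 => degw.
  rewrite szg ltnS -degw.
  have le_deg (F : {subfield M}) (p : {poly K}) t : p != 0 ->
      root (map_poly (in_alg M) p) t -> (adjoin_degree F t <= (size p).-1)%N.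
    move=> p_neq0 pt; rewrite -ltnS -size_minPoly prednK ?size_poly_gt0 //.
    rewrite -(size_map_poly (in_alg M)) dvdp_leq ?map_poly_eq0 //.
    by rewrite minPoly_dvdp ?alg_polyOver.
  by rewrite leq_mul ?le_deg.
- by rewrite -ku {1}DA kmap.
- by rewrite -kv {1}DB kmap.
Qed.

(** * Cardinalities of finite sets and products *)

Lemma card_seq_II (T : choiceType) (s : seq T) : uniq s ->
  ([set` s] #= `I_(size s))%card.
Proof.
move=> Us; have -> : [set` s] = [set` [fset x in s]%fset].
  by apply/seteqP; split=> x /=; rewrite !inE.
by apply/card_eq_fsetP; rewrite card_fseq undup_id.
Qed.

Lemma card_II_seq (T : choiceType) (A : set T) (n : nat) : (A #= `I_n)%card ->
  exists s : seq T, [/\ uniq s, size s = n & A = [set` s]].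
Proof.
move=> An; have finA : finite_set A by apply/finite_setP; exists n.
exists (fset_set A); split; [exact: fset_uniq | exact: card_fset_set |].
by rewrite -{1}(fset_setK finA).
Qed.

Lemma card_setX_II (T U : choiceType) (A : set T) (B : set U) (m n : nat) :
  (A #= `I_m)%card -> (B #= `I_n)%card -> (A `*` B #= `I_(m * n))%card.
Proof.
move=> /card_II_seq[s [Us <- ->]] /card_II_seq[t [Ut <- ->]].
rewrite -(size_allpairs pair) (_ : _ `*` _ = [set` [seq (x, y) | x <- s, y <- t]]).
  by apply: card_seq_II; apply: allpairs_uniq => // -[x y] [x' y'] _ _ /= [-> ->].
apply/seteqP; split=> [[x y] /= [xs yt]|_ /= /allpairsP[[x y] [xs yt ->]]] //.
by apply/allpairsP; exists (x, y).
Qed.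

(** * Linear disjointness and the cluster size of the compositum *)

Section Disjoint.

Variables (K : fieldType) (Kbar : closedFieldType).
Variable iota : {rmorphism K -> Kbar}.

(** Linear independence of 1, y, ..., y^(d-1) over [F], phrased with polynomials so that remainders
    modulo [b] fit it directly. *)
Definition powers_free (F : set Kbar) (d : nat) (y : Kbar) : Prop :=
  forall p : {poly Kbar}, (size p <= d)%N -> (forall k, F p`_k) -> root p y ->
    p = 0.

(** A relation over [K] among these powers is a polynomial of degree less than that of [b] vanishing
    at [y], hence zero. Linear disjointness carries this independence over to [F]. *)
Lemma linearly_disjoint_powers_free (E F : set Kbar) (b : {poly K}) (y : Kbar) :
  irreducible_poly b -> root (map_poly iota b) y -> (forall k, E (y ^+ k)) ->
  linearly_disjoint iota E F -> powers_free F (size b).-1 y.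
Proof.
move=> irr_b b_y Ey disj p; set d := (size b).-1 => size_p Fp py.
have free : lin_indep_over (range iota) (fun i : 'I_d => y ^+ i).
  move=> c /(_ _)/cid2 c_range.
  pose a i := s2val (c_range i); have Dc i : c i = iota (a i).
    by rewrite /a; case: (c_range i).
  pose q : {poly K} := rVpoly (\row_i a i).
  have size_q : (size q <= d)%N by apply: size_poly.
  have qi (i : 'I_d) : q`_i = a i by rewrite coef_rVpoly_ord mxE.
  move=> sum0; have qy : root (map_poly iota q) y.
    rewrite rootE (@horner_coef_wide _ d) ?size_map_poly // -[X in _ == X]sum0.
    by apply/eqP/eq_bigr => i _; rewrite coef_map qi Dc.
  suff q0 : q = 0 by move=> i; rewrite Dc -qi q0 coef0 rmorph0.
  apply/eqP/contraT => q_neq0; have := irreducible_dvdp irr_b b_y qy.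
  move=> /(dvdp_leq q_neq0); rewrite leqNgt (leq_ltn_trans size_q) //.
  by rewrite prednK // size_poly_gt0 irredp_neq0.
have py0 : \sum_(i < d) p`_i * y ^+ i = 0.
  by rewrite -horner_coef_wide //; apply/rootP.
have p0 := disj d _ (fun i => Ey i) free (fun i => p`_i) (fun i => Fp i) py0.
apply/polyP => i; rewrite coef0; have [lt_id|le_di] := ltnP i d.
  exact: p0 (Ordinal lt_id).
by rewrite nth_default // (leq_trans size_p).
Qed.

Variables f b : {poly K}.
Hypotheses (irr_f : irreducible_poly f) (irr_b : irreducible_poly b).
Hypothesis mon_b : b \is monic.
Let F := splitting_field iota f.
Let d := (size b).-1.

Lemma horner2_coef_splitting (R : {poly {poly K}}) (x : Kbar) k :
  root (map_poly iota f) x ->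
  F (map_poly (horner_eval x \o map_poly iota) R)`_k.
Proof.
move=> fx; rewrite coef_map /=; apply: adjoin_map_horner.
exact: sub_adjoin.
Qed.

(** Let [R] be the remainder of P - Q modulo b(Y). By freeness R(x, Y) is the zero polynomial, so
    each coefficient of [R] vanishes at [x], is divisible by [f], and vanishes at [x'] as well. *)
Lemma horner2_conj (x x' y y' : Kbar) (P Q : {poly {poly K}}) :
  root (map_poly iota f) x -> root (map_poly iota f) x' ->
  root (map_poly iota b) y -> root (map_poly iota b) y' ->
  powers_free F d y -> horner2 iota x y P = horner2 iota x y Q ->
  horner2 iota x' y' P = horner2 iota x' y' Q.
Proof.
move=> fx fx' b_y b_y' free_y /eqP; rewrite -subr_eq0 -horner2B => /eqP PQ0.
apply/eqP; rewrite -subr_eq0 -horner2B; apply/eqP; move: PQ0.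
have [R [size_R PR]] := horner2_reduce iota (P - Q) mon_b.
rewrite !PR // => R0.
have Rx0 : map_poly (horner_eval x \o map_poly iota) R = 0.
  apply: free_y; last exact/rootP.
    by rewrite (leq_trans (size_poly _ _)) // -ltnS prednK // (leq_trans _ size_R).
  by move=> k; apply: horner2_coef_splitting.
rewrite horner2E (_ : map_poly _ R = 0) ?horner0 //.
apply/polyP => k; rewrite coef0 coef_map /= /horner_eval.
have Rk : root (map_poly iota R`_k) x.
  by move/polyP/(_ k): Rx0; rewrite coef0 coef_map => /rootP.
have /dvdpP[q ->] := irreducible_dvdp irr_f fx Rk.
by rewrite rmorphM hornerM (rootP fx') mulr0.
Qed.

(** With [R] the remainder of [P] modulo b(Y), the polynomial R(x, Y) - x' has coefficients in the
    splitting field and vanishes at [y]. By freeness it is zero, and its constant coefficient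
    expresses [x'] through [x]. *)
Lemma splitting_root_in_adjoin (x x' y : Kbar) (P : {poly {poly K}}) :
  root (map_poly iota f) x -> root (map_poly iota f) x' ->
  root (map_poly iota b) y -> powers_free F d y ->
  x' = horner2 iota x y P -> adjoin iota [set x] x'.
Proof.
move=> fx fx' b_y free_y.
have [R [size_R ->]] // := horner2_reduce iota P mon_b.
move=> Dx'; set p := map_poly (horner_eval x \o map_poly iota) R.
(* Needed for the constant polynomial [x'] to have size at most [d]. *)
have d_gt0 : (0 < d)%N by have [] := irr_b; rewrite /d; case: (size b) => [|[]].
have : p - x'%:P = 0.
  apply: free_y.
  - rewrite (leq_trans (size_polyD _ _)) // size_polyN geq_max.
    rewrite (leq_trans (size_polyC_leq1 _)) // andbT.
    by rewrite (leq_trans (size_poly _ _)) // -ltnS prednK // (leq_trans _ size_R).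
  - move=> k; rewrite coefB coefC; apply: adjoinB.
      exact: horner2_coef_splitting.
    case: eqP => _; first exact: sub_adjoin.
    by rewrite -(rmorph0 iota); apply: adjoin_base.
  - by rewrite rootE hornerD hornerN hornerC {1}Dx' subrr.
move/polyP/(_ 0%N); rewrite coefB coefC coef0 => /eqP; rewrite subr_eq0.
move=> /eqP <-; rewrite /p coef_map /=; apply: adjoin_map_horner.
exact: sub_adjoin.
Qed.

Lemma adjoin_horner2 S (x y : Kbar) (P : {poly {poly K}}) :
  adjoin iota S x -> adjoin iota S y -> adjoin iota S (horner2 iota x y P).
Proof.
move=> xS yS; apply: adjoin_horner => // k.
by rewrite coef_map; apply: adjoin_map_horner.
Qed.

(** The Galois extension enters only through [b]: its roots have free powers over the splitting
    field of [f], and each of them generates all the others. *)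
Lemma compositum_cluster_size (r : nat) :
  perfect_field K -> cluster_size iota f r ->
  (forall y, root (map_poly iota b) y -> powers_free F d y) ->
  (forall y y', root (map_poly iota b) y -> root (map_poly iota b) y' ->
    adjoin iota [set y] y') ->
  exists g : {poly K},
    [/\ irreducible_poly g, size g = ((size f).-1 * d).+1
      & cluster_size iota g (r * d)].
Proof.
move=> perfK clusf free_b normal_b.
have [xs [Uxs size_f fE]] := irreducible_roots iota perfK irr_f.
have [ys [Uys size_b bE]] := irreducible_roots iota perfK irr_b.
have [x0 fx0] : exists x, root (map_poly iota f) x.
  by apply/closed_rootP; rewrite size_map_poly; case: irr_f => /gtn_eqF->.
have [y0 b_y0] : exists y, root (map_poly iota b) y.
  by apply/closed_rootP; rewrite size_map_poly; case: irr_b => /gtn_eqF->.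
have [g [A [B [P /= [[irr_g gz] size_g DA DB]]]]] :=
  primitive_pair perfK irr_f irr_b fx0 b_y0.
pose z x y := horner2 iota x y P.
have conj Q R x y : horner2 iota x0 y0 Q = horner2 iota x0 y0 R ->
    root (map_poly iota f) x -> root (map_poly iota b) y ->
    horner2 iota x y Q = horner2 iota x y R.
  by move=> QR fx b_y; apply: horner2_conj QR => //; apply: free_b.
have g_z x y : root (map_poly iota f) x -> root (map_poly iota b) y ->
    root (map_poly iota g) (z x y).
  (* The relations transferred from (x0, y0) to every pair are g(P) = 0 here, then A(P) = X and B(P)
     = Y. *)
  move=> fx b_y; have := conj (comp2 g P) 0%:P%:P x y.
  rewrite !horner2_comp !horner2CC rmorph0 => gz0.
  by apply/rootP/gz0 => //; apply/rootP.
have A_z x y : root (map_poly iota f) x -> root (map_poly iota b) y ->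
    (map_poly iota A).[z x y] = x.
  move=> fx b_y; have := conj (comp2 A P) 'X%:P x y.
  by rewrite !horner2_comp !horner2C map_polyX !hornerX; apply.
have B_z x y : root (map_poly iota f) x -> root (map_poly iota b) y ->
    (map_poly iota B).[z x y] = y.
  move=> fx b_y; have := conj (comp2 B P) 'X x y.
  by rewrite !horner2_comp !horner2X; apply.
pose zs := [seq z x y | x <- xs, y <- ys].
have size_zs : size zs = ((size f).-1 * d)%N.
  by rewrite size_allpairs /d size_f size_b.
(* The pair is recovered from its value z(x, y) by [A] and [B]. *)
have Uzs : uniq zs.
  apply: allpairs_uniq => //.
  move=> _ _ /allpairsP[[x y] /= [xsx ysy ->]] /allpairsP[[x' y'] /= [xsx' ysy' ->]].
  move=> /= eq_z.
  rewrite -fE in xsx; rewrite -fE in xsx'; rewrite -bE in ysy; rewrite -bE in ysy'.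
  congr (_, _); first by rewrite -(A_z x y) // eq_z A_z.
  by rewrite -(B_z x y) // eq_z B_z.
have g_neq0 : map_poly iota g != 0 by rewrite map_poly_eq0 irredp_neq0.
have g_zs : all (root (map_poly iota g)) zs.
  by apply/allP => _ /allpairsP[[x y] /= [xsx ysy ->]]; rewrite g_z ?fE ?bE.
have gE t : root (map_poly iota g) t -> exists x y,
    [/\ root (map_poly iota f) x, root (map_poly iota b) y & t = z x y].
  move=> gt; have [/allpairsP[[x y] /= [xsx ysy ->]]|ntz] := boolP (t \in zs).
    by exists x, y; rewrite fE bE.
  (* A root outside [zs] would give [g] one root more than its degree bound allows. *)
  have := @max_poly_roots _ _ (t :: zs) g_neq0.
  rewrite /= gt g_zs ntz Uzs => /(_ isT isT).
  by rewrite size_map_poly size_zs ltnNge size_g.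
exists g; split=> //.
  apply/eqP; rewrite eqn_leq size_g -size_zs.
  by have := max_poly_roots g_neq0 g_zs Uzs; rewrite size_map_poly.
move=> t /[dup] gt /gE[x [y [fx b_y Dt]]].
have Ax : adjoin iota [set t] x.
  by rewrite -(A_z x y) // -Dt; apply: adjoin_map_horner; apply: sub_adjoin.
have By : adjoin iota [set t] y.
  by rewrite -(B_z x y) // -Dt; apply: adjoin_map_horner; apply: sub_adjoin.
have -> : root_cluster iota g t =
    (fun u => z u.1 u.2) @` (root_cluster iota f x `*` [set` ys]).
  apply/seteqP; split=> [t' [gt' tt']|_ [[x' y'] /= [[fx' xx'] ysy'] <-]].
    have [x' [y' [fx' b_y' Dt']]] := gE _ gt'.
    exists (x', y') => //; split=> /=; last by rewrite -bE.
    (* x' = A(t') lies in K(t), so it is a polynomial in t = P(x, y); freeness then places it in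
       K(x). *)
    split=> //; have /(adjoin1P _ irr_g gt)[p Dp] : adjoin iota [set t] x'.
      by rewrite -(A_z x' y') // -Dt'; apply: adjoin_map_horner.
    apply: (@splitting_root_in_adjoin x x' y (comp2 p P)) => //.
      exact: free_b.
    by rewrite horner2_comp -/(z x y) -Dt.
  (* Conversely, [x'] lies in K(x) and [y'] in K(y), both contained in K(t). *)
  rewrite -bE in ysy'; split; first exact: g_z.
  apply: adjoin_horner2.
    by have /(adjoin1P _ irr_f fx)[p ->] := xx'; apply: adjoin_map_horner.
  have /(adjoin1P _ irr_b b_y)[p ->] := normal_b _ _ b_y ysy'.
  exact: adjoin_map_horner.
have inj_z : {in root_cluster iota f x `*` [set` ys] &,
    injective (fun u : Kbar * Kbar => z u.1 u.2)}.
  move=> [x1 y1] [x2 y2] /set_mem /= [[fx1 _] b_y1] /set_mem /= [[fx2 _] b_y2].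
  rewrite -bE in b_y1; rewrite -bE in b_y2 => eq_z.
  congr (_, _); first by rewrite -(A_z x1 y1) // eq_z A_z.
  by rewrite -(B_z x1 y1) // eq_z B_z.
apply: card_eq_trans (inj_card_eq inj_z) _; apply: card_setX_II.
  exact: clusf.
by rewrite /d size_b; apply: card_seq_II.
Qed.

End Disjoint.

(** * A generator of the Galois extension, and the conclusion *)

(** [b] is the minimal polynomial of a separable generator of [L]. By normality all its roots come
    from [L], and each has degree [d] over [K], so it generates [L]. *)
Lemma galois_subextension_generator (K : fieldType) (Kbar : closedFieldType)
    (iota : {rmorphism K -> Kbar}) (E : set Kbar) (d : nat) :
  galois_subextension iota E d ->
  exists b : {poly K}, [/\ irreducible_poly b /\ b \is monic, size b = d.+1,
    forall y k, root (map_poly iota b) y -> E (y ^+ k)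
    & forall y y', root (map_poly iota b) y -> root (map_poly iota b) y' ->
        adjoin iota [set y] y'].
Proof.
move=> [L [j [jE -> /and3P[_ sepL normL] dimL]]].
pose w := separable_generator 1 {:L}.
have genL : {:L}%VS = <<1; w>>%VS.
  by rewrite [LHS](eq_adjoin_separable_generator sepL) // sub1v.
have /polyOver1P[b Db] := minPolyOver 1 w.
have mapj p : map_poly j (map_poly (in_alg L) p) = map_poly iota p.
  by rewrite -map_poly_comp (eq_map_poly jE).
have size_b : size b = d.+1.
  rewrite -(size_map_poly (in_alg L)) -Db size_minPoly -dimL genL.
  by rewrite dim_Fadjoin dimv1 muln1.
have b_neq0 : b != 0 by rewrite -size_poly_eq0 size_b.
have bw : root (map_poly (in_alg L) b) w by rewrite -Db root_minPoly.
have irr_b : irreducible_poly b.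
  apply/(subfx_irreducibleP bw b_neq0) => q qw q_neq0.
  rewrite -(size_map_poly (in_alg L)) -Db -(size_map_poly (in_alg L) q).
  by rewrite dvdp_leq ?map_poly_eq0 // minPoly_dvdp ?alg_polyOver.
have rootL y : root (map_poly iota b) y ->
    exists2 u, y = j u & root (map_poly (in_alg L) b) u.
  (* [b] splits into linear factors over [L], so its roots in [Kbar] are the images under [j] of its
     roots in [L]. *)
  have [s _ Ds] := normalFieldP normL w (memvf w).
  rewrite -mapj -Db Ds rmorph_prod.
  under eq_bigr do rewrite rmorphB /= map_polyX map_polyC /=.
  rewrite -(big_map j predT (fun z => 'X - z%:P)) root_prod_XsubC.
  by move=> /mapP[u su ->]; exists u => //; rewrite root_prod_XsubC.
have genu u : root (map_poly (in_alg L) b) u -> <<1; u>>%VS = {:L}%VS.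
  move=> bu; apply/eqP; rewrite eqEdim subvf dimL dim_Fadjoin dimv1 muln1.
  have /polyOver1P[q Dq] := minPolyOver 1 u.
  have qu : root (map_poly (in_alg L) q) u by rewrite -Dq root_minPoly.
  have q_neq0 : q != 0.
    by rewrite -(map_poly_eq0 (in_alg L)) -Dq monic_neq0 ?monic_minPoly.
  (* [b] divides the minimal polynomial of [u], so the degree of [u] is at least [d], the dimension
     of [L]. *)
  rewrite -ltnS -size_minPoly -size_b Dq size_map_poly dvdp_leq //.
  exact: irreducible_dvdp irr_b bu qu.
exists b; split=> //.
- by split=> //; rewrite -(map_monic (in_alg L)) -Db monic_minPoly.
- by move=> y k /rootL[u -> _]; exists (u ^+ k); rewrite ?rmorphXn.
move=> y y' by0 by'; apply/(adjoin1P _ irr_b by0).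
have [u Dy bu] := rootL _ by0; have [u' Dy' _] := rootL _ by'.
have /Fadjoin1_polyP[p Du'] : u' \in <<1; u>>%VS by rewrite genu ?memvf.
by exists p; rewrite Dy' Dy {1}Du' -horner_map mapj.
Qed.

Lemma min_poly_irreducible (K : fieldType) (Kbar : closedFieldType)
    (iota : {rmorphism K -> Kbar}) (x : Kbar) (h : {poly K}) :
  min_poly iota x h -> irreducible_poly h.
Proof.
move=> [mon_h hx min_h]; apply/(subfx_irreducibleP hx (monic_neq0 mon_h)).
by move=> q qx q_neq0; apply: min_h.
Qed.

Theorem theorem1 (K : fieldType) (Kbar : closedFieldType)
    (iota : {rmorphism K -> Kbar})
    (perfK : perfect_field K)
    (closK : algebraic_closure iota)
    (alpha : Kbar) (f : {poly K}) (n r d : nat)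
    (fmin : min_poly iota alpha f)
    (degf : size f = n.+1)
    (n_gt2 : (2 < n)%N)
    (clusf : cluster_size iota f r)
    (exE : exists E : set Kbar,
        galois_subextension iota E d /\
        linearly_disjoint iota E (splitting_field iota f)) :
  exists g : {poly K},
    [/\ irreducible_poly g, size g = (n * d).+1
      & cluster_size iota g (r * d)].

Proof.
have irr_f := min_poly_irreducible fmin.
have [E [galE disjE]] := exE.
have [b [[irr_b mon_b] size_b powE normal_b]] := galois_subextension_generator galE.
have [|g [irr_g size_g cl_g]] :=
  compositum_cluster_size irr_f irr_b mon_b perfK clusf _ normal_b.
  (* Linear disjointness applies because all powers of a root of [b] lie in [E]. *)
  move=> y b_y; apply: linearly_disjoint_powers_free disjE => // k.
  exact: powE.
by exists g; rewrite size_b in cl_g; rewrite size_g degf size_b.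
Qed.
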